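(* Let $G$ be a finite, simple, connected graph with an even number $n$ of vertices. Then every optimal solution $S_{opt}$ to the Minimum Edge-Vertex Problem for $G$ satisfies $n/2\le |S_{opt}|\le n-1$. Both bounds are best possible: for every even $n\ge 2$ there is a connected graph of order $n$ whose optimal solutions have exactly $n/2$ edges (e.g. any connected graph of order $n$ with a perfect matching), and a connected graph of order $n$ whose optimal solution has exactly $n-1$ edges (e.g. the star $K_{1,n-1}$).
   Context: For a graph $G=(V,E)$, a solution to the Edge-Vertex Problem is a subset $X\subseteq E$ such that for every vertex $v\in V$ the number of edges of $X$ incident with $v$ is odd. The Minimum Edge-Vertex Problem asks for a solution of minimum cardinality; such a solution is called optimal. *)

(* Defs.v *)
From mathcomp Require Import all_boot.

Set Implicit Arguments.
Unset Strict Implicit.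
Unset Printing Implicit Defensive.

Record sgraph := SGraph {
  vertex :> finType;
  adj : rel vertex;
  adj_sym : symmetric adj;
  adj_irr : irreflexive adj
}.

(* The edge joining x and y is the two-element vertex set [set x; y]. *)
Definition edges (G : sgraph) : {set {set G}} :=
  [set [set p.1; p.2] | p : G * G & adj p.1 p.2].

(* The graph with no vertices is not counted as connected. *)
Definition connected_graph (G : sgraph) : Prop :=
  0 < #|G| /\ forall x y : G, connect (@adj G) x y.

Definition incident_in (G : sgraph) (X : {set {set G}}) (v : G) :
    {set {set G}} :=
  [set A in X | v \in A].

Definition ev_solution (G : sgraph) (X : {set {set G}}) : Prop :=
  X \subset edges G /\ forall v : G, odd #|incident_in X v|.

Definition optimal_solution (G : sgraph) (X : {set {set G}}) : Prop :=
  ev_solution X /\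
  forall Y : {set {set G}}, ev_solution Y -> #|X| <= #|Y|.

Definition optimal_size (G : sgraph) (k : nat) : Prop :=
  (exists X : {set {set G}}, optimal_solution X) /\
  forall X : {set {set G}}, optimal_solution X -> #|X| = k.

Definition perfect_matching (G : sgraph) (M : {set {set G}}) : Prop :=
  M \subset edges G /\ forall v : G, #|incident_in M v| = 1.

Definition star_adj (m : nat) : rel 'I_m.+1 :=
  fun i j => (i == ord0) != (j == ord0).

Lemma star_adj_sym m : symmetric (@star_adj m).
Proof. by move=> i j; rewrite /star_adj eq_sym. Qed.

Lemma star_adj_irr m : irreflexive (@star_adj m).
Proof. by move=> i; rewrite /star_adj eqxx. Qed.

(* The star K_{1,m}, with centre ord0 and m leaves. *)
Definition star (m : nat) : sgraph :=
  SGraph (@star_adj_sym m) (@star_adj_irr m).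

(* Main.v *)
Require Import Defs.
From mathcomp Require Import all_boot.

Set Implicit Arguments.
Unset Strict Implicit.
Unset Printing Implicit Defensive.

(** For the upper bound, grow a vertex set A one vertex at a time along edges
    leaving it, keeping the invariant that every even subset T of A is the
    set of odd-degree vertices of some edge set of fewer than #|A| edges
    inside A: a new vertex w attached to u contributes the edge uw exactly
    when w is in T, which toggles membership of u in the subset to be
    handled inside A.  The lower bound is the handshake identity.  In a star
    every leaf forces its only edge. *)

(** * Degree counting, the lower bound and perfect matchings *)

Lemma card_edge (G : sgraph) (A : {set G}) : A \in edges G -> #|A| = 2.
Proof.
case/imsetP=> [[x y]]; rewrite inE /= => xy ->; rewrite cards2.
by case: eqP xy => // ->; rewrite adj_irr.
Qed.

Lemma handshake (G : sgraph) (X : {set {set G}}) :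
  X \subset edges G -> \sum_(v : G) #|incident_in X v| = #|X|.*2.
Proof.
move=> XE.
under eq_bigr => v _ do rewrite -sum1dep_card.
(* Incident pairs of a vertex and an edge are now counted edge by edge, each edge contributing its
   two ends. *)
rewrite (exchange_big_dep (mem X)) /=; last by move=> v A _ /andP[].
rewrite -muln2 -sum_nat_const; apply: eq_bigr => A AX.
by rewrite AX /= sum1_card (card_edge (subsetP XE A AX)).
Qed.

Lemma ev_solution_ge_half (G : sgraph) (X : {set {set G}}) :
  ev_solution X -> #|G|./2 <= #|X|.
Proof.
case=> XE Xodd; rewrite -(doubleK #|X|) half_leq // -handshake //.
(* An odd degree is at least 1, so the degree sum is at least [#|G|]. *)
rewrite -sum1_card; apply: leq_sum => v _; exact: odd_gt0.
Qed.

Lemma perfect_matching_card (G : sgraph) (M : {set {set G}}) :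
  perfect_matching M -> #|M| = #|G|./2.
Proof.
case=> ME M1; rewrite -(doubleK #|M|) -handshake // -sum1_card.
by congr _./2; apply: eq_bigr.
Qed.

Lemma perfect_matching_solution (G : sgraph) (M : {set {set G}}) :
  perfect_matching M -> ev_solution M.
Proof. by case=> ME M1; split=> // v; rewrite M1. Qed.

Lemma perfect_matching_optimal_size (G : sgraph) (M : {set {set G}}) :
  perfect_matching M -> optimal_size G #|G|./2.
Proof.
move=> pM; have solM := perfect_matching_solution pM.
split=> [|X [solX minX]].
  exists M; split=> // Y solY.
  by rewrite (perfect_matching_card pM) ev_solution_ge_half.
apply/eqP; rewrite eqn_leq ev_solution_ge_half // andbT.
by rewrite -(perfect_matching_card pM) minX.
Qed.

(** * The upper bound by vertex-by-vertex growth *)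

Lemma connected_crossing_edge (G : sgraph) (A : {set G}) :
  connected_graph G -> 0 < #|A| < #|G| ->
  exists u w, [/\ u \in A, w \notin A & adj u w].
Proof.
case=> _ Gconn /andP[/card_gt0P[x xA] ltAG].
have [/existsP[u /existsP[w /and3P[uA wA uw]]]|] :=
  boolP [exists u, exists w, [&& u \in A, w \notin A & adj u w]].
  by exists u, w.
move=> noedge; suff AT : A = [set: G] by rewrite AT cardsT ltnn in ltAG.
apply/setP=> y; rewrite inE.
(* With no edge leaving [A], the set is closed under adjacency, so it contains everything reachable
   from [x]. *)
have clA : closed (@adj G) (mem A).
  apply: intro_closed => [a b|a b ab aA]; first by rewrite (sym_connect_sym (@adj_sym G)).
  apply: contraR noedge => bA; apply/existsP; exists a; apply/existsP; exists b.
  exact/and3P.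
by rewrite -(closed_connect clA (Gconn x y)).
Qed.

(** This is a [T]-join confined to [A], within the size of a spanning tree of [A]. Confinement
    guarantees that an edge to a vertex outside [A] is new. *)
Definition odd_join (G : sgraph) (A T : {set G}) (X : {set {set G}}) : Prop :=
  [/\ X \subset edges G, forall e, e \in X -> e \subset A, #|X| < #|A|
    & forall v, odd #|incident_in X v| = (v \in T)].

Lemma incident_setU1 (G : sgraph) (X : {set {set G}}) (e : {set G}) (v : G) :
  e \notin X -> #|incident_in (e |: X) v| = (v \in e) + #|incident_in X v|.
Proof.
move=> eX; have eI : e \notin incident_in X v by rewrite inE negb_and eX.
have [ve|ve] := boolP (v \in e).
  rewrite -[true + _](_ : #|e |: incident_in X v| = _); last by rewrite cardsU1 eI.
  apply: eq_card => f; rewrite !inE andb_orl; case: eqP => [->|] //=.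
  by rewrite ve.
apply: eq_card => f; rewrite !inE andb_orl; case: eqP => [->|] //=.
by rewrite (negbTE ve) andbF.
Qed.

Lemma odd_join_step {G : sgraph} {A : {set G}} {u w : G} :
  u \in A -> w \notin A -> adj u w ->
  (forall T : {set G}, T \subset A -> ~~ odd #|T| -> exists X, odd_join A T X) ->
  forall T : {set G}, T \subset w |: A -> ~~ odd #|T| ->
    exists X, odd_join (w |: A) T X.
Proof.
move=> uA wA uw IH T TA evT; have cA : #|w |: A| = #|A|.+1 by rewrite cardsU1 wA.
have uDw : u != w by apply: contraNneq wA => <-.
have [wT|wT] := boolP (w \in T); last first.
  have {}TA : T \subset A.
    apply/subsetP=> x xT; have := subsetP TA x xT.
    by rewrite !inE => /predU1P[xw|//]; rewrite -xw xT in wT.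
  have [X [XE XA Xlt Xodd]] := IH T TA evT; exists X; split=> //.
    by move=> e eX; apply: subset_trans (XA e eX) (subsetUr _ _).
  by rewrite cA ltnW.
(* Since [w] lies in [T], this is the symmetric difference of [T] and [[set u; w]]: [w] drops out
   and [u] is toggled. *)
pose T' := if u \in T then T :\ w :\ u else u |: (T :\ w).
have T'E v : (v \in T') = (v \in T) (+) (v \in [set u; w]).
  rewrite /T' !inE; case: (boolP (u \in T)) => uT; rewrite !inE.
    have [->|_] := eqVneq v u; first by rewrite uT.
    by have [->|_] := eqVneq v w; rewrite ?wT ?addbF.
  have [->|_] := eqVneq v u; first by rewrite (negbTE uT).
  by have [->|_] := eqVneq v w; rewrite ?wT ?addbF.
have T'A : T' \subset A.
  apply/subsetP=> v; rewrite T'E !inE.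
  have [->|_] := eqVneq v u; first by [].
  have [->|vw] := eqVneq v w; first by rewrite wT.
  by rewrite addbF => /(subsetP TA); rewrite !inE (negbTE vw).
(* Removing [w] and toggling [u] changes the cardinality by -2 or 0. *)
have evT' : ~~ odd #|T'|.
  have := evT; rewrite (cardsD1 w) wT /T'; case: ifP => uT.
    by rewrite (cardsD1 u) !inE uDw uT /= negbK.
  by rewrite cardsU1 !inE uDw uT /=.
have [X [XE XA Xlt Xodd]] := IH T' T'A evT'.
have eX : [set u; w] \notin X.
  by apply: contra wA => /XA/subsetP; apply; rewrite !inE eqxx orbT.
exists ([set u; w] |: X); split.
- rewrite subUset XE andbT sub1set; apply/imsetP; exists (u, w) => //.
  by rewrite inE.
- move=> e /setU1P[->|/XA eA]; last exact: subset_trans eA (subsetUr _ _).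
  by apply/subsetP=> v; rewrite !inE => /orP[]/eqP->; rewrite ?uA ?eqxx ?orbT.
- by rewrite cA cardsU1 eX.
(* The added edge flips the parity at [u] and [w] only, which cancels the symmetric difference and
   restores [T]. *)
- by move=> v; rewrite incident_setU1 // oddD Xodd T'E oddb addbCA addbb addbF.
Qed.

Lemma exists_joinable_set (G : sgraph) (k : nat) :
  connected_graph G -> k < #|G| ->
  exists2 A : {set G}, #|A| = k.+1 &
    forall T : {set G}, T \subset A -> ~~ odd #|T| -> exists X, odd_join A T X.
Proof.
move=> Gconn; elim: k => [|k IH] ltkG.
  have /card_gt0P[r _] := ltkG; exists [set r]; first exact: cards1.
  (* The only even subset of a singleton is empty, and the empty edge set joins it. *)
  move=> T; rewrite subset1 => /orP[/eqP->|/eqP->]; first by rewrite cards1.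
  move=> _; exists set0; split; rewrite ?sub0set ?cards0 ?cards1 //.
    by move=> e; rewrite inE.
  move=> v; rewrite inE (_ : incident_in _ _ = set0) ?cards0 //.
  by apply/setP=> e; rewrite !inE.
have [A cA joinA] := IH (ltnW ltkG).
have [u [w [uA wA uw]]] : exists u w, [/\ u \in A, w \notin A & adj u w].
  by apply: connected_crossing_edge => //; rewrite cA.
exists (w |: A); first by rewrite cardsU1 wA cA.
exact: odd_join_step uA wA uw joinA.
Qed.

Lemma exists_small_solution (G : sgraph) :
  connected_graph G -> ~~ odd #|G| ->
  exists2 X : {set {set G}}, ev_solution X & #|X| <= #|G|.-1.
Proof.
move=> Gconn evG; have [G0 _] := Gconn.
have [|A cA joinA] := @exists_joinable_set G #|G|.-1 Gconn; first by rewrite prednK.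
rewrite prednK // in cA.
have AT : A = [set: G].
  by apply/eqP; rewrite eqEcard subsetT cardsT cA leqnn.
(* The even order of [G] allows [T] to be the whole vertex set, which asks for odd degree
   everywhere. *)
have [|X [XE _ Xlt Xodd]] := joinA A (subxx A); first by rewrite cA.
exists X; last by rewrite -ltnS prednK // -cA.
by split=> // v; rewrite Xodd AT inE.
Qed.

Lemma exists_optimal (G : sgraph) (X : {set {set G}}) :
  ev_solution X -> exists Y : {set {set G}}, optimal_solution Y.
Proof.
(* A boolean form of [ev_solution], as required by [arg_minnP]. *)
pose sol (Y : {set {set G}}) :=
  (Y \subset edges G) && [forall v, odd #|incident_in Y v|].
have solP Y : reflect (ev_solution Y) (sol Y).
  by apply: (iffP andP) => -[YE /forallP].
move=> /solP solX; case: (arg_minnP (fun Y : {set {set G}} => #|Y|) solX).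
move=> Y solY minY; exists Y.
by split=> [|Z solZ]; [exact/solP | apply/minY/solP].
Qed.

Lemma optimal_solution_bounds (G : sgraph) (S : {set {set G}}) :
  connected_graph G -> ~~ odd #|G| -> optimal_solution S ->
  #|G|./2 <= #|S| <= #|G|.-1.
Proof.
move=> Gconn evG [solS minS]; rewrite ev_solution_ge_half //=.
have [X solX leX] := exists_small_solution Gconn evG.
exact: leq_trans (minS X solX) leX.
Qed.

(** * Stars attain the upper bound *)

Lemma star_connected m : connected_graph (star m).
Proof.
split=> [|x y]; first by rewrite card_ord.
have conn0 (z : star m) : connect (@adj (star m)) (ord0 : 'I_m.+1) z.
  have [->|z0] := eqVneq z (ord0 : 'I_m.+1); first exact: connect0.
  by apply: connect1; rewrite /= /star_adj eqxx (negbTE z0).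
apply: connect_trans (conn0 y).
by rewrite (sym_connect_sym (@adj_sym (star m))).
Qed.

Lemma star_solution_ge m (X : {set {set star m}}) :
  ev_solution X -> m <= #|X|.
Proof.
case=> XE Xodd.
pose spoke (i : 'I_m) : {set star m} := [set (ord0 : 'I_m.+1); lift ord0 i].
have spoke_inj : injective spoke.
  move=> i j /setP/(_ (lift ord0 i)); rewrite !inE eqxx orbT.
  by move/esym/orP=> [//|/eqP/lift_inj].
rewrite -[m in m <= _]card_ord -(card_imset _ spoke_inj).
apply/subset_leq_card/subsetP=> _ /imsetP[i _ ->].
have /card_gt0P[e] := odd_gt0 (Xodd (lift ord0 i)).
rewrite inE => /andP[eX]; have /imsetP[[x y]] := subsetP XE e eX.
rewrite inE /= /star_adj => xy e_xy; rewrite e_xy in eX *.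
(* The leaf is one end of [e]; as exactly one end of an edge is the centre, the other end is [ord0]
   and [e] is the spoke. *)
rewrite !inE => /orP[]/eqP li; move: xy; rewrite -li.
  have [y0 _|] := eqVneq y (ord0 : 'I_m.+1); last by [].
  by rewrite /spoke setUC li -y0.
have [x0 _|] := eqVneq x (ord0 : 'I_m.+1); last by [].
by rewrite /spoke li -x0.
Qed.

(** Odd [m] makes the order [m.+1] even, so solutions exist and the general upper bound meets the
    spoke count. *)
Lemma star_optimal_size m : odd m -> optimal_size (star m) m.
Proof.
move=> oddm; have cs : #|star m| = m.+1 by rewrite card_ord.
have evs : ~~ odd #|star m| by rewrite cs /= negbK.
split=> [|X optX].
  have [X solX _] := exists_small_solution (star_connected m) evs.
  exact: exists_optimal solX.
have /andP[_] := optimal_solution_bounds (star_connected m) evs optX.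
rewrite cs /= => leXm; apply/eqP; rewrite eqn_leq leXm.
by case: optX => /star_solution_ge.
Qed.

(** * Complete graphs attain the lower bound *)

Definition complete (V : finType) : sgraph :=
  @SGraph V (fun x y => x != y) (fun x y => congr1 negb (eq_sym x y))
    (fun x => negbF (eqxx x)).

Lemma complete_connected (V : finType) :
  0 < #|V| -> connected_graph (complete V).
Proof.
move=> V0; split=> // x y; have [->|xy] := eqVneq x y; first exact: connect0.
exact: connect1.
Qed.

(** The factor [bool] gives two copies of [V]; each vertex is matched with its twin in the other
    copy. *)
Lemma complete_perfect_matching (V : finType) :
  exists M : {set {set complete (bool * V)%type}}, perfect_matching M.
Proof.
pose pair (i : V) : {set complete (bool * V)%type} := [set (true, i); (false, i)].
exists [set pair i | i : V]; split=> [|[b i]].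
  apply/subsetP=> _ /imsetP[i _ ->].
  by apply/imsetP; exists ((true, i), (false, i)); rewrite ?inE.
rewrite (_ : incident_in _ _ = [set pair i]) ?cards1 //.
apply/setP=> e; rewrite !inE; apply/andP/eqP => [[/imsetP[j _ ->]]|->].
  by rewrite !inE !xpair_eqE => /orP[]/andP[_ /eqP->].
by rewrite imset_f // !inE !xpair_eqE eqxx; case: b.
Qed.

Theorem theorem3p3 :
  (forall G : sgraph, connected_graph G -> ~~ odd #|G| ->
     forall S : {set {set G}}, optimal_solution S ->
       #|G|./2 <= #|S| <= #|G|.-1) /\
  (forall n : nat, ~~ odd n -> 2 <= n ->
     [/\ exists G : sgraph,
           [/\ connected_graph G, #|G| = n & optimal_size G n./2],
         forall G : sgraph, connected_graph G -> #|G| = n ->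
           (exists M : {set {set G}}, perfect_matching M) ->
           optimal_size G n./2,
         exists G : sgraph,
           [/\ connected_graph G, #|G| = n & optimal_size G n.-1]
       & [/\ connected_graph (star n.-1), #|star n.-1| = n
           & optimal_size (star n.-1) n.-1]]).
Proof.
split=> [G Gconn evG S optS|n evn n2]; first exact: optimal_solution_bounds.
have starP : [/\ connected_graph (star n.-1), #|star n.-1| = n
    & optimal_size (star n.-1) n.-1].
  split; first exact: star_connected.
    by rewrite card_ord prednK // ltnW.
  by apply: star_optimal_size; case: n evn n2 => //= n; rewrite negbK.
split=> // [|G _ <- [M pM]|]; last by exists (star n.-1).
(* Two copies of [n./2] points give exactly [n] vertices because [n] is even. *)
- pose K := complete (bool * 'I_n./2)%type.
  have cK : #|K| = n.
    by rewrite card_prod card_bool card_ord mul2n -[RHS]odd_double_half (negbTE evn).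
  exists K; split=> //; first by apply: complete_connected; rewrite cK ltnW.
  have [M pM] := complete_perfect_matching 'I_n./2.
  by rewrite -[n in n./2]cK; apply: perfect_matching_optimal_size pM.
- exact: perfect_matching_optimal_size pM.
Qed.
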